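(* Let $(M,L^M_1,L^M_2)$ and $(N,L^N_1,L^N_2)$ be generalized Kähler manifolds, with $J^M_++J^M_-$ and $J^N_++J^N_-$ invertible, and let $\varphi:M\to N$ be a map. (i) If $\varphi:(M,L^M_1)\to(N,L^N_1)$ and $\varphi:(M,J^M_{\pm})\to(N,J^N_{\pm})$ are holomorphic then $\varphi$ is a holomorphic Poisson morphism between the corresponding associated holomorphic Poisson manifolds; moreover, the converse holds if $\varphi$ is an immersion. (ii) If $\varphi:(M,L^M_2)\to(N,L^N_2)$ and, either, $\varphi:(M,J^M_+)\to(N,J^N_+)$ or $\varphi:(M,J^M_-)\to(N,J^N_-)$ are holomorphic maps then $\varphi$ is a holomorphic Poisson morphism between the associated holomorphic Poisson structures.
   Context: Manifolds are connected and smooth, maps are smooth. For a real vector space $V$, $E\subseteq V^{\mathbb C}$ and $\varepsilon\in\Lambda^2E^*$, $L(E,\varepsilon)=\{u+\alpha\in V^{\mathbb C}\oplus(V^{\mathbb C})^*\mid u\in E,\ \alpha|_E=\varepsilon(u,\cdot)\}$. A linear generalized complex structure on $V$ is a maximal isotropic subspace $L$ of $V^{\mathbb C}\oplus(V^{\mathbb C})^*$ (for $\langle u+\alpha,v+\beta\rangle=\tfrac12(\alpha(v)+\beta(u))$) with $L\cap\overline L=\{0\}$; then $L=L(E,\varepsilon)$ for a unique pair; its associated co-CR structure is $E$ and its associated Poisson structure is $L(E\cap\overline E,\mathrm{Im}(\varepsilon|_{E\cap\overline E}))$ (regarded on the real subspace with complexification $E\cap\overline E$), the graph of a bivector on $V$.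 A linear map is generalized complex linear if $f(E_V)\subseteq E_W$ and $f$ maps the bivector of $V$ to that of $W$. A generalized complex structure on $M$ is a complex subbundle $L$ of $T^{\mathbb C}M\oplus(T^{\mathbb C}M)^*$, pointwise a linear generalized complex structure, with sections closed under the Courant bracket $[X+\alpha,Y+\beta]=[X,Y]+\tfrac12 d(\iota_X\beta-\iota_Y\alpha)+\iota_Xd\beta-\iota_Yd\alpha$; $\mathcal J$ is the corresponding section of $\mathrm{End}(TM\oplus T^*M)$ with $\mathrm i$-eigenbundle $L$. A map between generalized complex manifolds is holomorphic if its differential at each point is generalized complex linear. A generalized Kähler manifold $(M,L_1,L_2)$ has two generalized complex structures whose $\mathcal J_1,\mathcal J_2$ commute and $\mathcal J_1\mathcal J_2$ is negative definite with respect to $\langle\cdot,\cdot\rangle$. It corresponds to a quadruple $(g,b,J_+,J_-)$, with $g$ a Riemannian metric, $b$ a two-form and $J_\pm$ (integrable) Hermitian structures on $(M,g)$, via $L_1=L^+\oplus L^-$, $L_2=L^+\oplus\overline{L^-}$, $L^\pm=\{X+(b\pm g)(X)\mid X\in T^{1,0}_\pm M\}$, $T^{1,0}_\pm M$ the $\mathrm i$-eigenbundles of $J_\pm$. If $J_++J_-$ is invertible then, up to a unique $B$-field transformation ($\exp(B)(X+\alpha)=X+\iota_XB+\alpha$, $B$ real closed two-form, applied to $L_1$ and $L_2$), $L_2=L(T^{\mathbb C}M,\mathrm i\,\varepsilon)$ for a symplectic form $\varepsilon$ on $M$. Let $\rho^\pm:T^{\mathbb C}M\to T^{1,0}_\pm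 M$ be the projections with kernel $T^{0,1}_\pm M$. The holomorphic Poisson structures associated to $(M,L_1,L_2)$ are $\rho^\pm_*\bigl(L(T^{\mathbb C}M,\mathrm i\,\varepsilon)\bigr)$, where, pointwise, $f_*(L)=\{f(X)+\xi\mid X+f^*(\xi)\in L\}$; these are the graphs of holomorphic Poisson bivectors (holomorphic sections of $\Lambda^2T^{1,0}_\pm M$) on $(M,J_\pm)$, respectively. A holomorphic Poisson morphism is a holomorphic map whose differential maps the holomorphic Poisson bivector of the domain to that of the codomain. Statements with $\pm$ refer to both signs: hypothesis and conclusion in (i) are for both $J_+$ and $J_-$ and their corresponding associated holomorphic Poisson structures. *)

(* Defs.v *)
From HB Require Import structures.
From mathcomp Require Import all_boot all_order all_algebra.
From mathcomp Require Import all_classical all_reals all_analysis.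
From mathcomp Require Import complex.

Set Implicit Arguments.
Unset Strict Implicit.
Unset Printing Implicit Defensive.

Import Order.TTheory GRing.Theory Num.Theory.
Import numFieldNormedType.Exports.

Local Open Scope classical_set_scope.
Local Open Scope ring_scope.

(* CONVENTIONS.  Vectors and covectors of F^n are row vectors.  A linear map  *)
(* is a matrix A acting by u |-> u *m A, and its transpose pulls covectors    *)
(* back by xi |-> xi *m A^T.  A bilinear form is a matrix B with value        *)
(* u *m B *m v^T, so that iota_u B = B(u, .) is the covector u *m B.          *)
(* u + alpha in V (+) V^* is the row vector row_mx u alpha; V^C is C^n, with  *)
(* V = R^n embedded by toC.                                                   *)

(* -------------------------- Linear algebra -------------------------------- *)

Section Linear.
Variables (F : fieldType) (n : nat).
Implicit Types (u v a : 'rV[F]_n) (x y : 'rV[F]_(n + n)).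

Definition ev a v : F := (v *m a^T) 0 0.

Definition bilin (B : 'M[F]_n) u v : F := (u *m B *m v^T) 0 0.

Definition pairing x y : F :=
  2%:R^-1 * (ev (rsubmx x) (lsubmx y) + ev (rsubmx y) (lsubmx x)).

Definition Lform (E : set 'rV[F]_n) (e : 'rV[F]_n -> 'rV[F]_n -> F) :
    set 'rV[F]_(n + n) :=
  [set x | E (lsubmx x) /\
           forall v, E v -> ev (rsubmx x) v = e (lsubmx x) v].

Definition skew (B : 'M[F]_n) : Prop := B^T = - B.

(* Zero diagonal is automatic: the fields used here have characteristic 0.    *)
Definition bivector_graph (P : 'M[F]_n) : set 'rV[F]_(n + n) :=
  [set row_mx (a *m P) a | a in [set: 'rV[F]_n]].

(* e restricts to an element of Lambda^2 E^* *)
Definition two_form_on (E : {vspace 'rV[F]_n})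
    (e : 'rV[F]_n -> 'rV[F]_n -> F) : Prop :=
  (forall u v w c, u \in E -> v \in E -> w \in E ->
     e (c *: u + v) w = c * e u w + e v w /\
     e w (c *: u + v) = c * e w u + e w v) /\
  (forall u, u \in E -> e u u = 0).

Definition expB (B : 'M[F]_n) (x : 'rV[F]_(n + n)) : 'rV[F]_(n + n) :=
  row_mx (lsubmx x) (lsubmx x *m B + rsubmx x).

(* f_*(L) = { f(X) + xi | X + f^*(xi) \in L } *)
Definition pushforward (f : 'M[F]_n) (L : set 'rV[F]_(n + n)) :
    set 'rV[F]_(n + n) :=
  [set x | exists X xi, L (row_mx X (xi *m f^T)) /\ x = row_mx (X *m f) xi].

Definition direct_sum (A B C : set 'rV[F]_(n + n)) : Prop :=
  A = [set b + c | b in B & c in C] /\ B `&` C = [set 0].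

End Linear.

Section Complexification.
Variable R : rcfType.

Definition toC p q (A : 'M[R]_(p, q)) : 'M[R[i]]_(p, q) :=
  map_mx (real_complex R) A.

Definition conj_mx p q (A : 'M[R[i]]_(p, q)) : 'M[R[i]]_(p, q) :=
  map_mx (@conjc R) A.

Definition conj_set p q (A : set 'M[R[i]]_(p, q)) : set 'M[R[i]]_(p, q) :=
  [set x | A (conj_mx x)].

Definition real_points p q (A : set 'M[R[i]]_(p, q)) : set 'M[R]_(p, q) :=
  [set x | A (toC x)].

Definition isotropic n (L : {vspace 'rV[R[i]]_(n + n)}) : Prop :=
  forall x y, x \in L -> y \in L -> pairing x y = 0.

Definition linear_gcs n (L : {vspace 'rV[R[i]]_(n + n)}) : Prop :=
  [/\ isotropic L,
      forall L', isotropic L' -> (L <= L')%VS -> L' = L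
    & [set` L] `&` conj_set [set` L] = [set 0]].

Definition gcs_pair n (L : {vspace 'rV[R[i]]_(n + n)})
    (E : {vspace 'rV[R[i]]_n}) (e : 'rV[R[i]]_n -> 'rV[R[i]]_n -> R[i]) :
    Prop :=
  two_form_on E e /\ [set` L] = Lform [set` E] e.

(* L(E `&` conj E, Im e), on the real subspace of V whose complexification is *)
(* the intersection of E and its conjugate.                                   *)
Definition gcs_poisson n (E : {vspace 'rV[R[i]]_n})
    (e : 'rV[R[i]]_n -> 'rV[R[i]]_n -> R[i]) : set 'rV[R]_(n + n) :=
  Lform (real_points ([set` E] `&` conj_set [set` E]))
        (fun u v => complex.Im (e (toC u) (toC v))).

Definition gc_linear m n (A : 'M[R]_(m, n))
    (LV : {vspace 'rV[R[i]]_(m + m)}) (LW : {vspace 'rV[R[i]]_(n + n)}) :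
    Prop :=
  exists EV eV EW eW,
    [/\ gcs_pair LV EV eV, gcs_pair LW EW eW,
        forall u, u \in EV -> u *m toC A \in EW
      & exists PV PW,
          [/\ skew PV, bivector_graph PV = gcs_poisson EV eV,
              skew PW, bivector_graph PW = gcs_poisson EW eW
            & A^T *m PV *m A = PW]].

Definition gc_endo n (L : {vspace 'rV[R[i]]_(n + n)}) (J : 'M[R]_(n + n)) :
    Prop :=
  forall x, (x *m toC J = 'i%C *: x) <-> x \in L.

Definition T10 n (J : 'M[R]_n) : 'M[R[i]]_n := eigenspace (toC J) 'i%C.
Definition T01 n (J : 'M[R]_n) : 'M[R[i]]_n := eigenspace (toC J) (- 'i%C).

Definition rho n (J : 'M[R]_n) : 'M[R[i]]_n := proj_mx (T10 J) (T01 J).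

(* { X + h(X) | X in T^{1,0} }; L^+ and L^- are the cases h = b + g, b - g.   *)
Definition Lgraph10 n (J h : 'M[R]_n) : set 'rV[R[i]]_(n + n) :=
  [set row_mx X (X *m toC h) | X in [set X : 'rV[R[i]]_n | (X <= T10 J)%MS]].

(* L(V^C, i eps) *)
Definition Lsymp n (eps : 'M[R]_n) : set 'rV[R[i]]_(n + n) :=
  Lform [set: 'rV[R[i]]_n] (bilin ('i%C *: toC eps)).

(* The graph is taken in V^C (+) (V^C)^*, elements of (T^{1,0})^* being       *)
(* replaced by all their extensions to V^C; thus Lambda^2 T^{1,0} is seen     *)
(* inside Lambda^2 V^C.                                                       *)
Definition assoc_bivector n (J eps : 'M[R]_n) (P : 'M[R[i]]_n) : Prop :=
  skew P /\ bivector_graph P = pushforward (rho J) (Lsymp eps).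

End Complexification.

(* --------------------------- Smooth manifolds ----------------------------- *)

Section Smoothness.
Variables (R : realType) (V W : normedModType R).

(* Meaningful for open U. *)
Fixpoint Ck (k : nat) (U : set V) (f : V -> W) : Prop :=
  if k is k'.+1 then
    (forall x, U x -> differentiable f x) /\
    (forall v, Ck k' U (fun x => 'D_v f x))
  else forall x, U x -> {for x, continuous f}.

Definition smooth (U : set V) (f : V -> W) : Prop := forall k, Ck k U f.

End Smoothness.

Record chart (R : realType) (n : nat) (T : topologicalType) := Chart {
  dom : set T;
  coord : T -> 'rV[R]_n;
  unchart : 'rV[R]_n -> T;
  dom_open : open dom;
  cod_open : open (coord @` dom);
  coord_cont : forall p, dom p -> {for p, continuous coord};
  unchart_cont : forall x, (coord @` dom) x -> {for x, continuous unchart};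
  coordK : forall p, dom p -> unchart (coord p) = p }.

Definition cod (R : realType) n (T : topologicalType) (c : chart R n T) :
  set 'rV[R]_n := coord c @` dom c.

(* chart_at p is a preferred chart around p: it identifies the tangent space  *)
(* at p with R^n, so that tensors at p are matrices and a field of tensors is *)
(* a function of p; such fields are compared with the other charts by         *)
(* chart_jac below.                                                           *)
Record manifold (R : realType) (n : nat) := Manifold {
  carrier :> topologicalType;
  carrier_hausdorff : hausdorff_space carrier;
  carrier_countable : @second_countable carrier;
  carrier_connected : connected [set: carrier];
  atlas : set (chart R n carrier);
  chart_at : carrier -> chart R n carrier;
  chart_at_atlas : forall p, atlas (chart_at p);
  chart_at_dom : forall p, dom (chart_at p) p;
  atlas_smooth : forall c d, atlas c -> atlas d ->
    smooth (coord c @` (dom c `&` dom d)) (coord d \o unchart c) }.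

Arguments atlas {R n} _ _.

Definition smooth_map (R : realType) m n (M : manifold R m) (N : manifold R n)
    (phi : M -> N) : Prop :=
  continuous phi /\
  forall c d, atlas M c -> atlas N d ->
    smooth (coord c @` (dom c `&` phi @^-1` dom d))
           (coord d \o phi \o unchart c).

Definition differential (R : realType) m n (M : manifold R m)
    (N : manifold R n) (phi : M -> N) (p : M) : 'M[R]_(m, n) :=
  jacobian (coord (chart_at (phi p)) \o phi \o unchart (chart_at p))
           (coord (chart_at p) p).

Definition immersion (R : realType) m n (M : manifold R m) (N : manifold R n)
    (phi : M -> N) : Prop :=
  forall p, row_free (differential phi p).

Section Fields.
Variables (R : realType) (n : nat) (M : manifold R n).
Local Notation C := R[i].
Implicit Types (c : chart R n M) (x : 'rV[R]_n) (U : set 'rV[R]_n).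

(* If u represents in the chart c a tangent vector at p = unchart c x, then   *)
(* u *m chart_jac c x represents it in the preferred chart at p.              *)
Definition chart_jac c x : 'M[R]_n :=
  jacobian (coord (chart_at (unchart c x)) \o unchart c) x.

Definition form_in (B : M -> 'M[R]_n) c x : 'M[R]_n :=
  chart_jac c x *m B (unchart c x) *m (chart_jac c x)^T.

Definition endo_in (J : M -> 'M[R]_n) c x : 'M[R]_n :=
  chart_jac c x *m J (unchart c x) *m invmx (chart_jac c x).

Definition vect_at c x (X : 'rV[C]_n) : 'rV[C]_n := X *m toC (chart_jac c x).

Definition gvect_at c x (s : 'rV[C]_(n + n)) : 'rV[C]_(n + n) :=
  row_mx (vect_at c x (lsubmx s))
         (rsubmx s *m (invmx (toC (chart_jac c x)))^T).

Definition smooth_form (B : M -> 'M[R]_n) : Prop :=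
  forall c, atlas M c -> smooth (cod c) (form_in B c).

Definition smooth_endo (J : M -> 'M[R]_n) : Prop :=
  forall c, atlas M c -> smooth (cod c) (endo_in J c).

Definition smoothC p q U (s : 'rV[R]_n -> 'M[C]_(p, q)) : Prop :=
  smooth U (fun x => map_mx (@complex.Re R) (s x)) /\
  smooth U (fun x => map_mx (@complex.Im R) (s x)).

Definition partial (i : 'I_n) (f : 'rV[R]_n -> R) x : R :=
  'D_(delta_mx 0 i) (f : 'rV[R]_n -> R^o) x.

Definition partialC (i : 'I_n) (f : 'rV[R]_n -> C) x : C :=
  (partial i (fun y => complex.Re (f y)) x +i*
   partial i (fun y => complex.Im (f y)) x)%C.

Definition lie_bracket (X Y : 'rV[R]_n -> 'rV[C]_n) x : 'rV[C]_n :=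
  \row_j \sum_(i < n) (X x 0 i * partialC i (fun y => Y y 0 j) x
                       - Y x 0 i * partialC i (fun y => X y 0 j) x).

(* iota_X d alpha *)
Definition contract_d (X a : 'rV[R]_n -> 'rV[C]_n) x : 'rV[C]_n :=
  \row_j \sum_(i < n) X x 0 i * (partialC i (fun y => a y 0 j) x
                                 - partialC j (fun y => a y 0 i) x).

Definition courant (s t : 'rV[R]_n -> 'rV[C]_(n + n)) x : 'rV[C]_(n + n) :=
  let X y := lsubmx (s y) in let a y := rsubmx (s y) in
  let Y y := lsubmx (t y) in let b y := rsubmx (t y) in
  row_mx (lie_bracket X Y x)
    (\row_j (2%:R^-1 * partialC j (fun y => ev (b y) (X y) - ev (a y) (Y y)) x)
     + contract_d X b x - contract_d Y a x).

Definition closed_form (B : M -> 'M[R]_n) : Prop :=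
  forall c x, atlas M c -> cod c x -> forall i j k,
    partial i (fun y => form_in B c y j k) x
    + partial j (fun y => form_in B c y k i) x
    + partial k (fun y => form_in B c y i j) x = 0.

Definition two_form (B : M -> 'M[R]_n) : Prop :=
  (forall p, skew (B p)) /\ smooth_form B.

Definition symplectic (e : M -> 'M[R]_n) : Prop :=
  [/\ two_form e, closed_form e & forall p, e p \in unitmx].

Definition riemannian (g : M -> 'M[R]_n) : Prop :=
  [/\ forall p, (g p)^T = g p,
      forall p (u : 'rV[R]_n), u != 0 -> 0 < bilin (g p) u u
    & smooth_form g].

Definition is_section10 (J : M -> 'M[R]_n) c U X : Prop :=
  smoothC U X /\
  forall x, U x -> (vect_at c x (X x) <= T10 (J (unchart c x)))%MS.

(* integrability: T^{1,0} is involutive *)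
Definition hermitian (g J : M -> 'M[R]_n) : Prop :=
  [/\ forall p, J p *m J p = - 1%:M,
      forall p, J p *m g p *m (J p)^T = g p,
      smooth_endo J
    & forall c U X Y, atlas M c -> open U -> U `<=` cod c ->
        is_section10 J c U X -> is_section10 J c U Y ->
        is_section10 J c U (lie_bracket X Y)].

Definition is_section (L : M -> {vspace 'rV[C]_(n + n)}) c U s : Prop :=
  smoothC U s /\ forall x, U x -> gvect_at c x (s x) \in L (unchart c x).

Definition subbundle (L : M -> {vspace 'rV[C]_(n + n)}) : Prop :=
  forall c x0, atlas M c -> cod c x0 ->
    exists U r (F : 'rV[R]_n -> 'M[C]_(r, n + n)),
      [/\ open U, U x0, U `<=` cod c, smoothC U F
        & forall x, U x -> row_free (F x) /\
            forall s, (s <= F x)%MS = (gvect_at c x s \in L (unchart c x))].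

Definition gen_complex (L : M -> {vspace 'rV[C]_(n + n)}) : Prop :=
  [/\ forall p, linear_gcs (L p),
      subbundle L
    & forall c U s t, atlas M c -> open U -> U `<=` cod c ->
        is_section L c U s -> is_section L c U t ->
        is_section L c U (courant s t)].

Definition gen_kahler (L1 L2 : M -> {vspace 'rV[C]_(n + n)}) : Prop :=
  [/\ gen_complex L1, gen_complex L2
    & forall p, exists J1 J2,
        [/\ gc_endo (L1 p) J1, gc_endo (L2 p) J2, J1 *m J2 = J2 *m J1
          & forall x : 'rV[R]_(n + n), x != 0 -> pairing (x *m (J1 *m J2)) x < 0]].

Definition kahler_quadruple (L1 L2 : M -> {vspace 'rV[C]_(n + n)})
    (g b Jp Jm : M -> 'M[R]_n) : Prop :=
  [/\ riemannian g, two_form b, hermitian g Jp, hermitian g Jm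
    & forall p,
        let Lp := Lgraph10 (Jp p) (b p + g p) in
        let Lm := Lgraph10 (Jm p) (b p - g p) in
        direct_sum [set` L1 p] Lp Lm /\
        direct_sum [set` L2 p] Lp (conj_set Lm)].

(* The B-field transformation taking L2 to L(T^C M, i eps).  It leaves J_+    *)
(* and J_- unchanged.                                                         *)
Definition B_normalization (L2 : M -> {vspace 'rV[C]_(n + n)})
    (B eps : M -> 'M[R]_n) : Prop :=
  [/\ two_form B, closed_form B, symplectic eps
    & forall p, expB (toC (B p)) @` [set` L2 p] = Lsymp (eps p)].

End Fields.

Section Morphisms.
Variables (R : realType) (m n : nat) (M : manifold R m) (N : manifold R n).
Variable phi : M -> N.

Definition holomorphic_gc (LM : M -> {vspace 'rV[R[i]]_(m + m)})
    (LN : N -> {vspace 'rV[R[i]]_(n + n)}) : Prop :=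
  forall p, gc_linear (differential phi p) (LM p) (LN (phi p)).

Definition holomorphic (JM : M -> 'M[R]_m) (JN : N -> 'M[R]_n) : Prop :=
  forall p, JM p *m differential phi p = differential phi p *m JN (phi p).

(* phi is a holomorphic Poisson morphism from M, with the structure           *)
(* rho_*(L(T^C M, i eps_M)) on (M, J_M), to N, with the analogous one.        *)
Definition holomorphic_poisson (JM epsM : M -> 'M[R]_m)
    (JN epsN : N -> 'M[R]_n) : Prop :=
  holomorphic JM JN /\
  exists (PM : M -> 'M[R[i]]_m) (PN : N -> 'M[R[i]]_n),
    [/\ forall p, assoc_bivector (JM p) (epsM p) (PM p),
        forall q, assoc_bivector (JN q) (epsN q) (PN q)
      & forall p, (toC (differential phi p))^T *m PM p
                    *m toC (differential phi p) = PN (phi p)].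

End Morphisms.

(* Main.v *)
(** Everything is pointwise linear algebra.  Write S and D for the sum and the
    difference of J_+ and J_-, and h for the inverse of eps.  Comparing L_2
    with the graph of i eps gives J_+ eps = B + b + g and
    J_- eps = g - B - b, hence 2 g = S eps and J_+^T h = - h J_-.  It follows
    that the associated holomorphic bivector on (M, J_±) is determined by J_±
    and by its real part, which is ∓ h D / 4.  The real Poisson bivector of
    L_2 is h, and that of L_1 is h S^-1 D; since D and S anticommute, the
    latter times S is - h D.  A map whose differential intertwines both J_+ and
    J_- intertwines S as well, so it preserves h S^-1 D if and only if it
    preserves h D. *)
Require Import Defs.
From mathcomp Require Import all_boot all_order all_algebra.
From mathcomp Require Import all_classical all_reals all_analysis.
From mathcomp Require Import complex.
Import Order.TTheory GRing.Theory Num.Theory.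
Import numFieldNormedType.Exports.
Local Open Scope ring_scope.

Set Implicit Arguments.
Unset Strict Implicit.

(** * Covectors, forms and graphs of bivectors *)

Section Evaluation.
Variables (F : fieldType) (n : nat).
Implicit Types a b u v : 'rV[F]_n.

Lemma evC a v : ev a v = ev v a.
Proof. by rewrite /ev -[in RHS](trmxK a) -trmx_mul [in RHS]mxE. Qed.

Lemma evDr a u v : ev a (u + v) = ev a u + ev a v.
Proof. by rewrite /ev mulmxDl mxE. Qed.

Lemma evZr (c : F) a v : ev a (c *: v) = c * ev a v.
Proof. by rewrite /ev -scalemxAl mxE. Qed.

Lemma evDl a b v : ev (a + b) v = ev a v + ev b v.
Proof. by rewrite evC evDr !(evC v). Qed.

Lemma evZl (c : F) a v : ev (c *: a) v = c * ev a v.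
Proof. by rewrite evC evZr (evC v). Qed.

Lemma evNl a v : ev (- a) v = - ev a v.
Proof. by rewrite -scaleN1r evZl mulN1r. Qed.

Lemma ev_delta a k : ev a (delta_mx 0 k) = a 0 k.
Proof. by rewrite /ev -rowE !mxE. Qed.

Lemma ev_inj a b : (forall v, ev a v = ev b v) -> a = b.
Proof. by move=> E; apply/rowP => k; rewrite -!ev_delta. Qed.

Lemma bilinE (B : 'M[F]_n) u v : bilin B u v = ev (u *m B) v.
Proof. by rewrite evC. Qed.

Lemma Lform_setT (B : 'M[F]_n) u a :
  Lform [set: _]%classic (bilin B) (row_mx u a) <-> a = u *m B.
Proof.
rewrite /Lform /= row_mxKl row_mxKr; split=> [[_ H]|->].
  by apply: ev_inj => v; rewrite H // bilinE.
by split=> // v _; rewrite bilinE.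
Qed.

(** Basis covectors determine a graph row by row, so an inclusion is enough. *)
Lemma bivector_graph_inj (P Q : 'M[F]_n) :
  (bivector_graph P `<=` bivector_graph Q)%classic -> P = Q.
Proof.
move=> PQ; apply/row_matrixP => k; rewrite !rowE.
have [a _ /eq_row_mx[<- <-] //] :
  bivector_graph Q (row_mx (delta_mx 0 k *m P) (delta_mx 0 k)).
by apply: PQ; exists (delta_mx 0 k).
Qed.

Lemma invmx_skew (B : 'M[F]_n) : B \in unitmx -> Defs.skew B -> Defs.skew (invmx B).
Proof.
move=> BU BN; rewrite /Defs.skew -[LHS]mulmx1 -(mulmxV BU) mulmxA.
have {2}-> : B = - B^T by rewrite BN opprK.
by rewrite mulmxN -trmx_mul mulmxV // trmx1 mulNmx mul1mx.
Qed.

End Evaluation.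

(** * Complex matrices split into real and imaginary parts *)

Section Cx.
Variable R : rcfType.
Local Notation i := ('i%C : R[i]).

Lemma toCD p q (A B : 'M[R]_(p, q)) : toC (A + B) = toC A + toC B.
Proof. exact: map_mxD. Qed.

Lemma toCN p q (A : 'M[R]_(p, q)) : toC (- A) = - toC A.
Proof. exact: map_mxN. Qed.

Lemma toCM p q r (A : 'M[R]_(p, q)) (B : 'M[R]_(q, r)) :
  toC (A *m B) = toC A *m toC B.
Proof. exact: map_mxM. Qed.

Lemma toCT p q (A : 'M[R]_(p, q)) : toC (A^T) = (toC A)^T.
Proof. by rewrite /toC map_trmx. Qed.

Lemma toC1 n : toC (1%:M : 'M[R]_n) = 1%:M.
Proof. exact: map_mx1. Qed.

Definition cx {p q} (u v : 'M[R]_(p, q)) : 'M[R[i]]_(p, q) := toC u + i *: toC v.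

Lemma cx_split p q (X : 'M[R[i]]_(p, q)) : exists u v, X = cx u v.
Proof.
exists (map_mx (@complex.Re R) X), (map_mx (@complex.Im R) X).
by apply/matrixP => j k; rewrite !mxE -complexE.
Qed.

Lemma cx_entry p q (u v : 'M[R]_(p, q)) j k : cx u v j k = (u j k +i* v j k)%C.
Proof. by rewrite !mxE; simpc. Qed.

Lemma cx_inj p q (u v u' v' : 'M[R]_(p, q)) :
  cx u v = cx u' v' -> u = u' /\ v = v'.
Proof.
move=> /matrixP E; split; apply/matrixP => j k; move: (E j k);
  by rewrite !cx_entry => -[].
Qed.

Lemma cx0 p q (u : 'M[R]_(p, q)) : toC u = cx u 0.
Proof. by rewrite /cx /toC raddf0 scaler0 addr0. Qed.

Lemma toC_inj p q : injective (@toC R p q).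
Proof. by move=> A B; rewrite !cx0 => /cx_inj[]. Qed.

Lemma cxD p q (u v u' v' : 'M[R]_(p, q)) :
  cx u v + cx u' v' = cx (u + u') (v + v').
Proof. by rewrite /cx !toCD scalerDr addrACA. Qed.

Lemma cxN p q (u v : 'M[R]_(p, q)) : - cx u v = cx (- u) (- v).
Proof. by rewrite /cx !toCN scalerN opprD. Qed.

Lemma i_cx p q (u v : 'M[R]_(p, q)) : i *: cx u v = cx (- v) u.
Proof.
by rewrite /cx scalerDr scalerA -expr2 sqr_i scaleN1r toCN addrC.
Qed.

Lemma cxM p q r (u v : 'M[R]_(p, q)) (B : 'M[R]_(q, r)) :
  cx u v *m toC B = cx (u *m B) (v *m B).
Proof. by rewrite /cx mulmxDl -scalemxAl !toCM. Qed.

Lemma cxMc p q r (u v : 'M[R]_(p, q)) (u' v' : 'M[R]_(q, r)) :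
  cx u v *m cx u' v' = cx (u *m u' - v *m v') (v *m u' + u *m v').
Proof.
by rewrite {2}/cx mulmxDr -scalemxAr !cxM i_cx cxD.
Qed.

Lemma conj_cx p q (u v : 'M[R]_(p, q)) : conj_mx (cx u v) = cx u (- v).
Proof. by apply/matrixP => j k; rewrite mxE !cx_entry !mxE. Qed.

Lemma row_cx p q r (u v : 'M[R]_(p, q)) (u' v' : 'M[R]_(p, r)) :
  row_mx (cx u v) (cx u' v') = cx (row_mx u u') (row_mx v v').
Proof. by rewrite /cx /toC !map_row_mx scale_row_mx add_row_mx. Qed.

(** * The projection onto the holomorphic tangent space *)

Section OneJ.
Variables (n : nat) (J : 'M[R]_n).

Lemma T10P (X : 'rV[R[i]]_n) : reflect (X *m toC J = i *: X) (X <= T10 J)%MS.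
Proof. exact: eigenspaceP. Qed.

Hypothesis J2 : J *m J = - 1%:M.

Lemma T10_cx (u : 'rV[R]_n) : (cx u (- (u *m J)) <= T10 J)%MS.
Proof.
by apply/T10P; rewrite cxM i_cx mulNmx -mulmxA J2 mulmxN mulmx1 !opprK.
Qed.

(** The rows of 1 - i J lie in [T10 J], those of 1 + i J in [T01 J], and the two matrices add up to
    2. *)
Lemma rhoE : rho J = 2^-1 *: cx 1%:M (- J).
Proof.
have two0 : (2 : R[i]) != 0 by rewrite pnatr_eq0.
have iJ : cx 1%:M (- J) *m toC J = i *: cx 1%:M (- J).
  by rewrite cxM i_cx mulNmx J2 mul1mx !opprK.
have iJ' : cx 1%:M J *m toC J = (- i) *: cx 1%:M J.
  by rewrite cxM scaleNr i_cx cxN J2 mul1mx opprK.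
have cap0 : (T10 J :&: T01 J)%MS = 0.
  apply/eqP; rewrite -submx0; apply/rV_subP => w.
  rewrite sub_capmx => /andP[/eigenspaceP w1 /eigenspaceP].
  rewrite w1 scaleNr => /eqP; rewrite -addr_eq0 -mulr2n -scaler_nat scalerA.
  rewrite scaler_eq0 mulf_eq0 (negPf two0) /= => /orP[|/eqP->]; last exact: sub0mx.
  by rewrite eq_complex /= oner_eq0 andbF.
have e1 : cx 1%:M (- J) *m rho J = cx 1%:M (- J).
  by apply: proj_mx_id => //; apply/eigenspaceP.
have e2 : cx 1%:M J *m rho J = 0.
  by apply: proj_mx_0 => //; apply/eigenspaceP.
have : (cx 1%:M (- J) + cx 1%:M J) *m rho J = cx 1%:M (- J).
  by rewrite mulmxDl e1 e2 addr0.
rewrite cxD addNr -cx0 toCD toC1 mulmxDl !mul1mx -mulr2n -scaler_nat => <-.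
by rewrite scalerA mulVf // scale1r.
Qed.

End OneJ.

(** * The associated holomorphic bivector as a matrix *)

Section Assoc.
Variables (n : nat) (J eps : 'M[R]_n).
Hypotheses (epsN : Defs.skew eps) (epsU : eps \in unitmx).

(** With r = [rho J], the element X + a r^T lies in [Lsymp eps] exactly when X = - i a r^T eps^-1;
    the pushforward then pairs a with X r. *)
Definition assoc_mx : 'M[R[i]]_n :=
  - i *: ((rho J)^T *m toC (invmx eps) *m rho J).

Lemma assoc_mxP (P : 'M[R[i]]_n) : assoc_bivector J eps P <-> P = assoc_mx.
Proof.
have LsympE x a : Lsymp eps (row_mx x a) <-> a = x *m (i *: toC eps).
  exact: Lform_setT.
have skewA : Defs.skew assoc_mx.
  rewrite /assoc_mx /Defs.skew; move: (rho J) => r.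
  rewrite linearZ /= !trmx_mul trmxK -toCT (invmx_skew epsU epsN) toCN.
  by rewrite mulNmx mulmxN scalerN mulmxA.
have graphA : bivector_graph assoc_mx = Defs.pushforward (rho J) (Lsymp eps).
  rewrite /assoc_mx; move: (rho J) => r.
  apply/seteqP; split=> [_ [a _ <-]|_ [X [a [/LsympE Xa ->]]]].
    exists (- i *: (a *m r^T *m toC (invmx eps))), a; split.
      apply/LsympE; rewrite -scalemxAl -scalemxAr scalerA mulNr -expr2 sqr_i.
      by rewrite opprK scale1r -!mulmxA -toCM mulVmx // toC1 mulmx1.
    by rewrite -scalemxAl -scalemxAr !mulmxA.
  exists a => //; rewrite -scalemxAr !mulmxA Xa.
  rewrite -!scalemxAr -!scalemxAl scalerA mulNr -expr2 sqr_i opprK scale1r.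
  by rewrite -(mulmxA X (toC eps)) -toCM mulmxV // toC1 mulmx1.
split=> [[_]|->]; last by [].
by rewrite -graphA => E; apply: bivector_graph_inj; rewrite E.
Qed.

End Assoc.

(** * The associated bivector in terms of its real part *)

Section AssocReal.
Variables (n : nat) (J J' eps : 'M[R]_n).
Hypotheses (J2 : J *m J = - 1%:M) (J'2 : J' *m J' = - 1%:M).
Hypothesis JT : J^T *m invmx eps = - (invmx eps *m J').

(* - 4 times the real part of the associated bivector, see assoc_mxE. *)
Definition re_bivector : 'M[R]_n := invmx eps *m (J - J').

(** [JT] turns (1 - i J^T) eps^-1 into eps^-1 (1 + i J'). That the imaginary part is - J^T times the
    real one expresses type (2,0): such a bivector P satisfies J^T P = i P. *)
Lemma assoc_mxE :
  assoc_mx J eps = - 4^-1 *: cx re_bivector (- (J^T *m re_bivector)).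
Proof.
rewrite /assoc_mx rhoE // [(_ *: _)^T]linearZ /= -!scalemxAl -scalemxAr !scalerA.
have -> : (cx 1%:M (- J))^T = cx 1%:M (- J^T).
  by rewrite /cx linearD linearZ /= -!toCT trmx1 linearN.
rewrite cxM mul1mx mulNmx JT opprK cxMc !mulmx1 !mulmxN.
have -> : (- i / 2 / 2 : R[i]) = - 4^-1 * i.
  rewrite !mulNr -mulrA -invfM -natrM mulrC //.
rewrite -scalerA i_cx; congr (_ *: cx _ _); rewrite /re_bivector.
  by rewrite addrC opprD opprK mulmxBr addrC.
rewrite mulmxA JT mulNmx opprK mulmxBr -[in RHS]mulmxA -(mulmxA _ J' J') J'2.
by rewrite mulmxN mulmx1 !opprK addrC mulmxA.
Qed.

End AssocReal.

(** Since A^T J^T = K^T A^T, the equation of imaginary parts follows from that of real parts. *)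
Lemma assoc_mx_map m n (A : 'M[R]_(m, n)) (J J' e : 'M[R]_m) (K K' f : 'M[R]_n) :
  J *m J = - 1%:M -> J' *m J' = - 1%:M -> J^T *m invmx e = - (invmx e *m J') ->
  K *m K = - 1%:M -> K' *m K' = - 1%:M -> K^T *m invmx f = - (invmx f *m K') ->
  J *m A = A *m K ->
  ((toC A)^T *m assoc_mx J e *m toC A = assoc_mx K f <->
   A^T *m re_bivector J J' e *m A = re_bivector K K' f).
Proof.
move=> J2 J'2 JT K2 K'2 KT JA.
rewrite (assoc_mxE J2 J'2 JT) (assoc_mxE K2 K'2 KT).
have four : (- 4^-1 : R[i]) != 0 by rewrite oppr_eq0 invr_eq0 pnatr_eq0.
rewrite -scalemxAr -scalemxAl -toCT.
rewrite [toC A^T]cx0 cxMc !mul0mx subr0 add0r cxM !mulmxN mulNmx.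
have -> : A^T *m (J^T *m re_bivector J J' e) *m A
    = K^T *m (A^T *m re_bivector J J' e *m A).
  by rewrite !mulmxA -trmx_mul JA trmx_mul.
split=> [/(scalerI four)/cx_inj[//]|-> //].
Qed.

(** * The real bivector of the first structure against [re_bivector] *)

Section Poisson1.
Variables (n : nat) (Jp Jm eps : 'M[R]_n).
Hypotheses (Jp2 : Jp *m Jp = - 1%:M) (Jm2 : Jm *m Jm = - 1%:M).
Hypothesis SU : Jp + Jm \in unitmx.

Definition poisson1 : 'M[R]_n := invmx eps *m invmx (Jp + Jm) *m (Jp - Jm).

(** The squares cancel, which leaves the commutator of [Jp] and [Jm] in one product and its opposite
    in the other. *)
Lemma anticommute : (Jp - Jm) *m (Jp + Jm) = - ((Jp + Jm) *m (Jp - Jm)).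
Proof.
rewrite !mulmxDr !mulmxDl !mulmxN !mulNmx Jp2 Jm2.
by rewrite !opprD !opprK [LHS]addrC [LHS]addrACA [LHS]addrC.
Qed.

Lemma re_bivectorE : re_bivector Jp Jm eps = - (poisson1 *m (Jp + Jm)).
Proof. by rewrite -mulmxA anticommute mulmxN mulmxA mulmxKV // opprK. Qed.

End Poisson1.

(** As [A] intertwines the sums, the second equation is the first one multiplied on the right by the
    invertible - (Kp + Km). *)
Lemma poisson1_map m n (A : 'M[R]_(m, n)) (Jp Jm e : 'M[R]_m) (Kp Km f : 'M[R]_n) :
  Jp *m Jp = - 1%:M -> Jm *m Jm = - 1%:M -> Jp + Jm \in unitmx ->
  Kp *m Kp = - 1%:M -> Km *m Km = - 1%:M -> Kp + Km \in unitmx ->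
  Jp *m A = A *m Kp -> Jm *m A = A *m Km ->
  (A^T *m poisson1 Jp Jm e *m A = poisson1 Kp Km f <->
   A^T *m re_bivector Jp Jm e *m A = re_bivector Kp Km f).
Proof.
move=> Jp2 Jm2 JU Kp2 Km2 KU JpA JmA.
have SA : (Jp + Jm) *m A = A *m (Kp + Km) by rewrite mulmxDl mulmxDr JpA JmA.
have -> : A^T *m re_bivector Jp Jm e *m A
    = - (A^T *m poisson1 Jp Jm e *m A *m (Kp + Km)).
  by rewrite re_bivectorE // mulmxN mulNmx -!mulmxA SA.
rewrite (re_bivectorE f Kp2 Km2 KU).
split=> [-> //|/oppr_inj]; exact: (can_inj (mulmxK KU)).
Qed.

(** * A maximal isotropic subspace as L(E, e) *)

Section MaximalIsotropic.
Variables (n : nat) (L : {vspace 'rV[R[i]]_(n + n)}).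
Hypothesis Liso : Defs.isotropic L.
Hypothesis Lmax : forall L', Defs.isotropic L' -> (L <= L')%VS -> L' = L.

Let E := (linfun (@lsubmx _ 1 n n) @: L)%VS.

Let EP u : reflect (exists2 x, x \in L & u = lsubmx x) (u \in E).
Proof.
by apply: (iffP memv_imgP) => -[x xL ->]; exists x; rewrite ?lfunE.
Qed.

(** An arbitrary element of [L] over [u]; the default 0 occurs only outside [E]. *)
Let lift u := xget 0 [set x | x \in L /\ lsubmx x = u]%classic.

Let liftP u : u \in E -> lift u \in L /\ lsubmx (lift u) = u.
Proof.
case/EP=> x xL ->.
exact: (@xgetPex _ 0 [set y | y \in L /\ lsubmx y = lsubmx x]%classic
  (ex_intro _ x (conj xL erefl))).
Qed.

Let e u v := ev (rsubmx (lift u)) v.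

(** Pairing [x] with an element of [L] over [v] leaves only half of this value. Hence two lifts of
    one vector agree on [E], and [e] does not depend on the choice. *)
Let annihilate x v : x \in L -> lsubmx x = 0 -> v \in E -> ev (rsubmx x) v = 0.
Proof.
move=> xL x0 /EP[y yL ->]; have /eqP := Liso xL yL.
rewrite /pairing x0 /ev mul0mx [X in _ + X]mxE addr0 mulf_eq0 invr_eq0.
by rewrite pnatr_eq0 => /eqP.
Qed.

Let two_form_lift : two_form_on E e.
Proof.
split=> [u v w c uE vE wE|u uE].
  split; last by rewrite /e evDr evZr.
  have [uL ul] := liftP uE; have [vL vl] := liftP vE.
  have [sL sl] := liftP (memvD (memvZ c uE) vE).
  (* The defect of linearity comes from a combination of lifts that lies in [L] over 0. *)
  apply/eqP; rewrite -subr_eq0 /e -evZl -evDl -evNl -evDl -!linearP -linearB /=.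
  apply/eqP; apply: annihilate => //; first by rewrite memvB // memvD // memvZ.
  by rewrite linearB linearP /= ul vl sl subrr.
have [uL ul] := liftP uE; have /eqP := Liso uL uL.
rewrite /pairing ul -/(e u u) mulf_eq0 invr_eq0 pnatr_eq0 /=.
by rewrite -mulr2n mulrn_eq0 /= => /eqP.
Qed.

Lemma gcs_pair_exists : exists E e, gcs_pair L E e /\
  forall u, u \in E <-> exists a, row_mx u a \in L.
Proof.
exists E, e; split; last first.
  move=> u; split=> [/EP[x xL ->]|[a aL]].
    by exists (rsubmx x); rewrite hsubmxK.
  by apply/EP; exists (row_mx u a); rewrite ?row_mxKl.
split=> //; apply/seteqP; split=> [x xL|x [/= xE H]].
  have xE : lsubmx x \in E by apply/EP; exists x.
  have [uL ul] := liftP xE; split=> // v vE.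
  apply/eqP; rewrite -subr_eq0 /e -evNl -evDl -linearB /=.
  apply/eqP; apply: annihilate => //; first by rewrite memvB.
  by rewrite linearB /= ul subrr.
(* Here [y] is a covector vanishing on [E], hence orthogonal to [L] and to itself. Adjoining it
   keeps [L] isotropic, so maximality puts it in [L]. *)
have [uL ul] := liftP xE; pose y := x - lift (lsubmx x).
have yl : lsubmx y = 0 by rewrite linearB /= ul subrr.
have yr v : v \in E -> ev (rsubmx y) v = 0.
  by move=> vE; rewrite linearB /= evDl evNl H // subrr.
have xy : x = y + lift (lsubmx x) by rewrite subrK.
move: y yl yr xy => y yl yr xy.
have ev0 (a : 'rV[R[i]]_n) : ev a 0 = 0 by rewrite /ev mul0mx mxE.
have yL' : Defs.isotropic (L + <[y]>)%VS.
  move=> x1 x2 /memv_addP[a aL [_ /vlineP[k ->] ->]].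
  move=> /memv_addP[b bL [_ /vlineP[l ->] ->]].
  have := Liso aL bL; rewrite /pairing !linearD !linearZ /= yl !scaler0 !addr0.
  rewrite !evDl !evZl !yr ?mulr0 ?addr0 //; apply/EP; [by exists a|by exists b].
have : y \in (L + <[y]>)%VS by apply: (subvP (addvSr _ _)); exact: memv_line.
rewrite (Lmax yL' (addvSl _ _)) => yL.
by rewrite [x]xy; apply: memvD.
Qed.

End MaximalIsotropic.

Lemma ev_cx n (c a v : 'rV[R]_n) : ev (cx c a) (toC v) = (ev c v +i* ev a v)%C.
Proof. by rewrite evC /ev -toCT cxM cx_entry -!/(ev _ _) !(evC v). Qed.

(** * Real Poisson bivectors and generalized complex linear maps *)

Section RealBivector.
Variables (n : nat) (L : {vspace 'rV[R[i]]_(n + n)}) (P : 'M[R]_n).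

(* P is the bivector of L: writing a covector as the imaginary part of an
   element of L with real vector part a *m P, we avoid mentioning E and eps. *)
Definition has_bivector : Prop :=
  forall a, exists c, row_mx (toC (a *m P)) (cx c a) \in L.

Hypothesis LP : has_bivector.

(** The imaginary part of the isotropy relation between the elements chosen for a and b reads a(b P)
    + b(a P) = 0. *)
Lemma has_bivector_skew : Defs.isotropic L -> Defs.skew P.
Proof.
move=> Liso.
have evP a b : ev a (b *m P) = - ev b (a *m P).
  have [c cL] := LP a; have [d dL] := LP b.
  have /eqP := Liso _ _ cL dL.
  rewrite /pairing !row_mxKl !row_mxKr !ev_cx mulf_eq0 invr_eq0 pnatr_eq0 /=.
  by rewrite eq_complex /= => /andP[_]; rewrite addr_eq0 => /eqP.
apply/matrixP => j k; have := evP (delta_mx 0 j) (delta_mx 0 k).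
by rewrite !(evC (delta_mx _ _)) !ev_delta -!rowE !mxE => ->.
Qed.

(** Subtracting the element chosen for [a] leaves a real element of [L]; it also lies in the
    conjugate of [L], so it vanishes. *)
Lemma has_bivector_real u c a :
  linear_gcs L -> row_mx (toC u) (cx c a) \in L -> u = a *m P.
Proof.
move=> [_ _ L0] uL; have [d dL] := LP a.
pose w := row_mx (u - a *m P) (c - d).
have wL : toC w \in L.
  have -> : toC w = row_mx (toC u) (cx c a) - row_mx (toC (a *m P)) (cx d a).
    by rewrite opp_row_mx add_row_mx !cx0 !cxN !cxD row_cx oppr0 addr0 subrr row_mx0.
  exact: memvB.
have : ([set` L] `&` conj_set [set` L])%classic (toC w).
  by split; rewrite //= /conj_set /= cx0 conj_cx oppr0 -cx0.
rewrite L0 /= -(map_mx0 (real_complex R)) => /toC_inj.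
by rewrite -row_mx0 => /eq_row_mx[/eqP]; rewrite subr_eq0 => /eqP.
Qed.

(** The vector [a *m P] is real, so it lies in [E] and its conjugate, and the covector over it has
    imaginary part [a]. The pair is arbitrary because [gc_linear] only asserts that some pairs
    exist. *)
Lemma gcs_poisson_sup E e :
  gcs_pair L E e -> (bivector_graph P `<=` gcs_poisson E e)%classic.
Proof.
move=> [_ LE] _ [a _ <-]; have [c cL] := LP a.
have : Lform [set` E]%classic e (row_mx (toC (a *m P)) (cx c a)) by rewrite -LE.
rewrite /Lform /= row_mxKl row_mxKr => -[uE H].
rewrite /gcs_poisson /Lform /= row_mxKl row_mxKr /real_points /conj_set /=.
split; first by rewrite cx0 conj_cx oppr0 -cx0.
by move=> v [vE _]; rewrite -H // ev_cx.
Qed.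

Lemma gcs_poissonE E e : linear_gcs L -> gcs_pair L E e ->
  (forall u, u \in E -> exists a, row_mx u a \in L) ->
  bivector_graph P = gcs_poisson E e.
Proof.
move=> Lgcs LE EL; apply/seteqP; split; first exact: gcs_poisson_sup.
move=> x; rewrite -[x]hsubmxK; move: (lsubmx x) (rsubmx x) => u a.
rewrite /gcs_poisson /Lform /= row_mxKl row_mxKr /real_points /conj_set /=.
move=> [[uE _] H]; have [al aL] := EL _ uE.
have [c [a' ea]] := cx_split al; rewrite ea in aL.
exists a => //; congr (row_mx _ _).
rewrite (has_bivector_real Lgcs aL).
have PT := has_bivector_skew (let: And3 i _ _ := Lgcs in i).
(* The covectors [a] and [a'] agree on the real points of [E], which contain the image of [P];
   skewness of [P] turns this into the vanishing. *)
suff : (a - a') *m P = 0 by rewrite mulmxBl => /eqP; rewrite subr_eq0 => /eqP.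
apply: oppr_inj; rewrite oppr0 -mulmxN -PT.
apply: ev_inj => b; have -> : ev ((a - a') *m P^T) b = ev (a - a') (b *m P).
  by rewrite /ev trmx_mul trmxK mulmxA.
have bE : real_points ([set` E] `&` conj_set [set` E])%classic (b *m P).
  have /(gcs_poisson_sup LE) : bivector_graph P (row_mx (b *m P) b) by exists b.
  by rewrite /gcs_poisson /Lform /= row_mxKl => -[].
have : Lform [set` E]%classic e (row_mx (toC u) (cx c a')) by case: LE => _ <-.
rewrite /Lform /= row_mxKl row_mxKr => -[_ H'].
case: (bE) => bE1 _; rewrite evDl evNl H // -H' // ev_cx subrr.
by rewrite /ev trmx0 mulmx0 mxE.
Qed.

End RealBivector.

Lemma gc_linear_bivector m n (A : 'M[R]_(m, n)) LV LW P Q :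
  has_bivector LV P -> has_bivector LW Q -> gc_linear A LV LW ->
  A^T *m P *m A = Q.
Proof.
move=> LP LQ [E [e [E' [e' [Le Le' _ [P' [Q' [_ eP' _ eQ' PQ]]]]]]]].
have -> : P = P' by apply: bivector_graph_inj; rewrite eP'; exact: gcs_poisson_sup.
by rewrite PQ; apply/esym/bivector_graph_inj; rewrite eQ'; exact: gcs_poisson_sup.
Qed.

(** The condition on vectors is the inclusion of co-CR structures, stated without naming the
    pairs. *)
Lemma gc_linear_intro m n (A : 'M[R]_(m, n)) LV LW P Q :
  linear_gcs LV -> linear_gcs LW -> has_bivector LV P -> has_bivector LW Q ->
  (forall u a, row_mx u a \in LV -> exists a', row_mx (u *m toC A) a' \in LW) ->
  A^T *m P *m A = Q -> gc_linear A LV LW.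
Proof.
move=> gV gW LP LQ LA PQ.
have [[isoV maxV _] [isoW maxW _]] := (gV, gW).
have [E [e [Ee EL]]] := gcs_pair_exists isoV maxV.
have [E' [e' [Ee' EL']]] := gcs_pair_exists isoW maxW.
exists E, e, E', e'; split=> //.
  by move=> u /EL[a /LA ?]; apply/EL'.
exists P, Q; split=> //; try exact: has_bivector_skew LP isoV;
  try exact: has_bivector_skew LQ isoW.
- by apply: gcs_poissonE => // u /EL.
- by apply: gcs_poissonE => // u /EL'.
Qed.
End Cx.

(** * Generalized Kähler linear algebra at a point *)

Section KahlerPoint.
Variables (R : realType) (n : nat) (M : manifold R n).
Variables (L1 L2 : M -> {vspace 'rV[R[i]]_(n + n)}).
Variables (g b Jp Jm B eps : M -> 'M[R]_n).
Hypothesis quad : kahler_quadruple L1 L2 g b Jp Jm.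
Hypothesis norm : B_normalization L2 B eps.
Variable p : M.

Lemma Jp_sqr : Jp p *m Jp p = - 1%:M.
Proof. by case: quad => _ _ [/(_ p)]. Qed.

Lemma Jm_sqr : Jm p *m Jm p = - 1%:M.
Proof. by case: quad => _ _ _ [/(_ p)]. Qed.

Lemma eps_skew : Defs.skew (eps p).
Proof. by case: norm => _ _ [[/(_ p)]]. Qed.

Lemma eps_unit : eps p \in unitmx.
Proof. by case: norm => _ _ [_ _ /(_ p)]. Qed.

(** After the B-field transformation, membership of the element over X = u + i v reads X (B + h) = i
    X eps; this is the real part. *)
Lemma Lsymp_graph u v h :
  row_mx (cx u v) (cx u v *m toC h) \in L2 p ->
  u *m (B p + h) = - (v *m eps p).
Proof.
move=> uL; case: norm => _ _ _ /(_ p) LE.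
have : Lsymp (eps p) (expB (toC (B p)) (row_mx (cx u v) (cx u v *m toC h))).
  by rewrite -LE; exists (row_mx (cx u v) (cx u v *m toC h)).
rewrite /expB row_mxKl row_mxKr -mulmxDr -toCD => /Lform_setT.
by rewrite -scalemxAr !cxM i_cx => /cx_inj[].
Qed.

Lemma mem_direct_sum (A C D : set 'rV[R[i]]_(n + n)) x :
  direct_sum A C D -> C x \/ D x -> A x.
Proof.
move=> [-> CD0]; have [C0 D0] : (C `&` D)%classic 0 by rewrite CD0.
case=> [Cx|Dx]; first by exists x => //; exists 0 => //; rewrite addr0.
by exists 0 => //; exists x => //; rewrite add0r.
Qed.

Lemma Jp_eps : Jp p *m eps p = B p + (b p + g p).
Proof.
case: quad => _ _ _ _ /(_ p) [_ L2E].
apply/row_matrixP => k; rewrite !rowE mulmxA; set u := delta_mx 0 k.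
(* The vector u - i u J_+ lies in T10 of J_+, and [L2 p] contains L^+. *)
rewrite (@Lsymp_graph u (- (u *m Jp p))) ?mulNmx ?opprK //.
apply: (mem_direct_sum L2E); left; exists (cx u (- (u *m Jp p))) => //.
exact/T10_cx/Jp_sqr.
Qed.

Lemma Jm_eps : Jm p *m eps p = - (B p + (b p - g p)).
Proof.
case: quad => _ _ _ _ /(_ p) [_ L2E].
apply/row_matrixP => k; rewrite !rowE mulmxA mulmxN; set u := delta_mx 0 k.
(* Now [L2 p] contains the conjugate of L^-, so the vector is u + i u J_-. *)
rewrite (@Lsymp_graph u (u *m Jm p)) ?opprK //.
apply: (mem_direct_sum L2E); right; exists (cx u (- (u *m Jm p))).
  exact/T10_cx/Jm_sqr.
by rewrite /conj_mx map_row_mx -!/(conj_mx _) !cxM !conj_cx mulNmx.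
Qed.

(** Transposition fixes [g] and negates [b], [B] and [eps], so it exchanges the right-hand sides of
    [Jp_eps] and [Jm_eps]. *)
Lemma Jp_adj : (Jp p)^T *m invmx (eps p) = - (invmx (eps p) *m Jm p).
Proof.
have epsJ : eps p *m (Jp p)^T = - (Jm p *m eps p).
  have [[gT _ _] [bT _] _ _ _] := quad; have [[BT _] _ _ _] := norm.
  have := congr1 trmx Jp_eps; rewrite trmx_mul eps_skew !linearD /= gT bT BT.
  rewrite mulNmx Jm_eps opprK => /eqP; rewrite eqr_oppLR => /eqP ->.
  by rewrite !opprD !opprK.
rewrite -[LHS](mulKmx eps_unit) (mulmxA (eps p)) epsJ mulNmx mulmxK ?eps_unit //.
by rewrite mulmxN.
Qed.

Lemma Jm_adj : (Jm p)^T *m invmx (eps p) = - (invmx (eps p) *m Jp p).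
Proof.
have := congr1 trmx Jp_adj; rewrite linearN /= !trmx_mul trmxK.
by rewrite (invmx_skew eps_unit eps_skew) mulNmx mulmxN opprK => <-.
Qed.

Lemma g_eps : g p + g p = (Jp p + Jm p) *m eps p.
Proof.
rewrite mulmxDl Jp_eps Jm_eps opprD addrACA subrr add0r opprB addrC.
by rewrite addrA subrK.
Qed.

(** L(i eps) contains u + i a for u = a eps^-1. Undoing the B-field transformation adds the real
    covector - u B and leaves the imaginary part alone. *)
Lemma L2_bivector : has_bivector (L2 p) (invmx (eps p)).
Proof.
move=> a; set u := a *m _; exists (- (u *m B p)).
have ue : u *m eps p = a by rewrite mulmxKV ?eps_unit.
have : Lsymp (eps p) (row_mx (toC u) (cx 0 a)).
  by apply/Lform_setT; rewrite cx0 -scalemxAr cxM i_cx ue mul0mx oppr0.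
case: norm => _ _ _ /(_ p) <- [z zL]; rewrite /expB => /eq_row_mx[zu za].
have <- : z = row_mx (toC u) (cx (- (u *m B p)) a); last by [].
rewrite -[z]hsubmxK zu; congr row_mx; move: za; rewrite zu => za.
apply: (addrI (toC u *m toC (B p))); rewrite za.
by rewrite [toC u]cx0 cxM cxD mul0mx subrr add0r.
Qed.

Lemma L1_mem X Y : (X <= T10 (Jp p))%MS -> (Y <= T10 (Jm p))%MS ->
  row_mx (X + Y) (X *m toC (b p + g p) + Y *m toC (b p - g p)) \in L1 p.
Proof.
case: quad => _ _ _ _ /(_ p) [[L1E _] _] XT YT; rewrite -add_row_mx.
pose x := row_mx X (X *m toC (b p + g p)).
pose y := row_mx Y (Y *m toC (b p - g p)).
have xL : Lgraph10 (Jp p) (b p + g p) x.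
  by exists X; [exact: XT | reflexivity].
have yL : Lgraph10 (Jm p) (b p - g p) y.
  by exists Y; [exact: YT | reflexivity].
have : [set` L1 p]%classic (x + y) by rewrite L1E; exists x => //; exists y.
by [].
Qed.

Hypothesis SU : Jp p + Jm p \in unitmx.

Lemma L1_bivector : has_bivector (L1 p) (poisson1 (Jp p) (Jm p) (eps p)).
Proof.
(* Since 2 g = (J_+ + J_-) eps, this [w] satisfies 2 w g = a. The vectors [X] and [Y] below lie in
   T10 of J_+ and of J_-, with imaginary parts w and - w: their sum is the real w (J_+ - J_-), and
   the covector over it has imaginary part w (b + g) - w (b - g) = a. *)
move=> a; pose w := a *m invmx (eps p) *m invmx (Jp p + Jm p).
have -> : a *m poisson1 (Jp p) (Jm p) (eps p) = w *m Jp p - w *m Jm p.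
  by rewrite /poisson1 /w !mulmxA mulmxBr.
have wg : w *m g p + w *m g p = a.
  by rewrite -mulmxDr g_eps mulmxA mulmxKV // mulmxKV ?eps_unit.
pose X := cx (w *m Jp p) w; pose Y := cx (- (w *m Jm p)) (- w).
have XT : (X <= T10 (Jp p))%MS.
  have := T10_cx Jp_sqr (w *m Jp p).
  by rewrite -(mulmxA w) Jp_sqr mulmxN mulmx1 opprK.
have YT : (Y <= T10 (Jm p))%MS.
  have := T10_cx Jm_sqr (- (w *m Jm p)).
  by rewrite mulNmx opprK -(mulmxA w) Jm_sqr mulmxN mulmx1.
exists (w *m Jp p *m (b p + g p) - w *m Jm p *m (b p - g p)).
have := L1_mem XT YT; rewrite !cxM !cxD subrr -cx0 !mulNmx.
suff -> : w *m (b p + g p) - w *m (b p - g p) = a by [].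
by rewrite -mulmxBr opprB addrC addrA subrK mulmxDr.
Qed.

(** The co-CR structure of [L1] is the sum of the two holomorphic tangent spaces, a form in which
    maps intertwining both J_+ and J_- visibly preserve it. *)
Lemma L1_projP u : (exists a, row_mx u a \in L1 p) <->
  exists X Y, [/\ X *m toC (Jp p) = 'i%C *: X, Y *m toC (Jm p) = 'i%C *: Y & u = X + Y].
Proof.
case: quad => _ _ _ _ /(_ p) [[L1E _] _]; split=> [[a]|[X [Y [/T10P XT /T10P YT ->]]]].
  move=> aL; have : [set` L1 p]%classic (row_mx u a) by [].
  rewrite L1E => -[_ [X /T10P XT <-] [_ [Y /T10P YT <-]]].
  by rewrite add_row_mx => /eq_row_mx[<- _]; exists X, Y.
by exists (X *m toC (b p + g p) + Y *m toC (b p - g p)); apply: L1_mem.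
Qed.

End KahlerPoint.

(** * Holomorphic Poisson morphisms as pointwise matrix equations *)

Section HolomorphicPoisson.
Variables (R : realType) (m n : nat) (M : manifold R m) (N : manifold R n).
Variable phi : M -> N.
Variables (J e : M -> 'M[R]_m) (K f : N -> 'M[R]_n).
Hypotheses (J2 : forall p, J p *m J p = - 1%:M) (eN : forall p, Defs.skew (e p))
  (eU : forall p, e p \in unitmx).
Hypotheses (K2 : forall q, K q *m K q = - 1%:M) (fN : forall q, Defs.skew (f q))
  (fU : forall q, f q \in unitmx).

Lemma holomorphic_poissonE :
  holomorphic_poisson phi J e K f <->
  Defs.holomorphic phi J K /\
  forall p, (toC (differential phi p))^T *m assoc_mx (J p) (e p)
    *m toC (differential phi p) = assoc_mx (K (phi p)) (f (phi p)).
Proof.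
split=> [[hol [P [Q [PE QE PQ]]]]|[hol PQ]]; split=> //.
  move=> p; have := PQ p.
  have /(assoc_mxP _ (eN p) (eU p)) -> := PE p.
  by have /(assoc_mxP _ (fN _) (fU _)) -> := QE (phi p).
exists (fun p => assoc_mx (J p) (e p)), (fun q => assoc_mx (K q) (f q)).
by split=> // [p|q]; apply/assoc_mxP.
Qed.

(** One complex structure suffices: a map intertwining [J] and [K] intertwines their projections,
    and [assoc_mx] is built from these and the inverse symplectic form. *)
Lemma holomorphic_poisson_inv : Defs.holomorphic phi J K ->
  (forall p, (differential phi p)^T *m invmx (e p) *m differential phi p
    = invmx (f (phi p))) ->
  holomorphic_poisson phi J e K f.
Proof.
move=> hol ef; apply/holomorphic_poissonE; split=> // p.
move: (differential phi p) (hol p) (ef p) => A JA efp.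
have rA : rho (J p) *m toC A = toC A *m rho (K (phi p)).
  rewrite !rhoE // -scalemxAl -scalemxAr; congr (_ *: _).
  by rewrite cxM [toC A]cx0 cxMc !mul0mx subr0 add0r mul1mx mulmx1 mulNmx mulmxN JA.
rewrite /assoc_mx -efp !toCM toCT.
move: (rho (J p)) (rho (K (phi p))) rA => r s rA.
rewrite -scalemxAr -scalemxAl; congr (_ *: _).
by rewrite -!mulmxA rA !mulmxA -trmx_mul rA trmx_mul.
Qed.

Variables (J' : M -> 'M[R]_m) (K' : N -> 'M[R]_n).
Hypotheses (J'2 : forall p, J' p *m J' p = - 1%:M)
  (JT : forall p, (J p)^T *m invmx (e p) = - (invmx (e p) *m J' p)).
Hypotheses (K'2 : forall q, K' q *m K' q = - 1%:M)
  (KT : forall q, (K q)^T *m invmx (f q) = - (invmx (f q) *m K' q)).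

Lemma holomorphic_poisson_re :
  holomorphic_poisson phi J e K f <->
  Defs.holomorphic phi J K /\
  forall p, (differential phi p)^T *m re_bivector (J p) (J' p) (e p)
    *m differential phi p = re_bivector (K (phi p)) (K' (phi p)) (f (phi p)).
Proof.
rewrite holomorphic_poissonE.
suff E p : J p *m differential phi p = differential phi p *m K (phi p) ->
    ((toC (differential phi p))^T *m assoc_mx (J p) (e p)
    *m toC (differential phi p) = assoc_mx (K (phi p)) (f (phi p)) <->
    (differential phi p)^T *m re_bivector (J p) (J' p) (e p)
    *m differential phi p = re_bivector (K (phi p)) (K' (phi p)) (f (phi p))).
  by split=> -[hol PQ]; split=> // p; apply/(E p (hol p)).
by move=> hol; apply: assoc_mx_map.
Qed.

End HolomorphicPoisson.

Unset Implicit Arguments.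

Theorem corollary6p8 (R : realType) (m n : nat)
    (M : manifold R m) (N : manifold R n)
    (L1M L2M : M -> {vspace 'rV[R[i]]_(m + m)})
    (L1N L2N : N -> {vspace 'rV[R[i]]_(n + n)})
    (kahlerM : gen_kahler L1M L2M) (kahlerN : gen_kahler L1N L2N)
    (gM bM JpM JmM : M -> 'M[R]_m) (gN bN JpN JmN : N -> 'M[R]_n)
    (quadM : kahler_quadruple L1M L2M gM bM JpM JmM)
    (quadN : kahler_quadruple L1N L2N gN bN JpN JmN)
    (invM : forall p, JpM p + JmM p \in unitmx)
    (invN : forall q, JpN q + JmN q \in unitmx)
    (BM epsM : M -> 'M[R]_m) (BN epsN : N -> 'M[R]_n)
    (normM : B_normalization L2M BM epsM)
    (normN : B_normalization L2N BN epsN)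
    (phi : M -> N) (phi_smooth : smooth_map phi) :
  (((holomorphic_gc phi L1M L1N /\
     holomorphic phi JpM JpN /\ holomorphic phi JmM JmN) ->
    holomorphic_poisson phi JpM epsM JpN epsN /\
    holomorphic_poisson phi JmM epsM JmN epsN)
   /\
   (immersion phi ->
    holomorphic_poisson phi JpM epsM JpN epsN /\
    holomorphic_poisson phi JmM epsM JmN epsN ->
    holomorphic_gc phi L1M L1N /\
    holomorphic phi JpM JpN /\ holomorphic phi JmM JmN))
  /\
  ((holomorphic_gc phi L2M L2N -> holomorphic phi JpM JpN ->
    holomorphic_poisson phi JpM epsM JpN epsN)
   /\
   (holomorphic_gc phi L2M L2N -> holomorphic phi JmM JmN ->
    holomorphic_poisson phi JmM epsM JmN epsN)).
Proof.
have Mp := Jp_sqr quadM; have Mm := Jm_sqr quadM.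
have Np := Jp_sqr quadN; have Nm := Jm_sqr quadN.
have MeN := eps_skew normM; have MeU := eps_unit normM.
have NeN := eps_skew normN; have NeU := eps_unit normN.
have poissonp := holomorphic_poisson_re phi Mp MeN MeU Np NeN NeU
  Mm (Jp_adj quadM normM) Nm (Jp_adj quadN normN).
have poissonm := holomorphic_poisson_re phi Mm MeN MeU Nm NeN NeU
  Mp (Jm_adj quadM normM) Np (Jm_adj quadN normN).
(* Exchanging the two complex structures only changes the sign, so the real equations for J_+ and
   J_- are equivalent. *)
have reC k (J J' f : 'M[R]_k) : re_bivector J' J f = - re_bivector J J' f.
  by rewrite /re_bivector -mulmxN opprB.
have L1M_pi p := L1_bivector quadM normM (invM p).
have L1N_pi q := L1_bivector quadN normN (invN q).
have inv_map : holomorphic_gc phi L2M L2N -> forall p,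
    (differential phi p)^T *m invmx (epsM p) *m differential phi p
    = invmx (epsN (phi p)).
  move=> hol p; apply: gc_linear_bivector (hol p);
    [exact: L2_bivector normM p|exact: L2_bivector normN (phi p)].
split; [split=> [[hol [holp holm]]|_ [pp pm]]|split=> hol holJ].
- have re p : (differential phi p)^T *m re_bivector (JpM p) (JmM p) (epsM p)
      *m differential phi p
      = re_bivector (JpN (phi p)) (JmN (phi p)) (epsN (phi p)).
    apply/poisson1_map => //; try exact: holp; try exact: holm.
    exact: gc_linear_bivector (hol p).
  split; first exact/poissonp.
  apply/poissonm; split=> // p.
  by rewrite reC [RHS]reC mulmxN mulNmx re.
- have [holp re] := poissonp.1 pp; have [holm _] := poissonm.1 pm.
  split=> // p.
  have [[gcsM _ _] _ _] := kahlerM; have [[gcsN _ _] _ _] := kahlerN.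
  apply: (gc_linear_intro (gcsM p) (gcsN (phi p)) (L1M_pi p) (L1N_pi (phi p))).
    (* The differential maps each of the two eigenvector summands of [u] to an eigenvector of the
       corresponding structure on [N]. *)
    move=> u a uL; apply/(L1_projP quadN).
    have /(L1_projP quadM) [X [Y [XT YT ->]]] : exists a, row_mx u a \in L1M p.
      by exists a.
    exists (X *m toC (differential phi p)), (Y *m toC (differential phi p)).
    split; last exact: mulmxDl.
      by rewrite -mulmxA -toCM -holp toCM mulmxA XT scalemxAl.
    by rewrite -mulmxA -toCM -holm toCM mulmxA YT scalemxAl.
  by apply/poisson1_map.
- exact: holomorphic_poisson_inv (inv_map hol).
- exact: holomorphic_poisson_inv (inv_map hol).
Qed.
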